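(* Let $G$ be a finitely labeled graph. The following are equivalent: (a) $G$ is a generalized Cayley graph of a left-cancellative magma; (b) $G$ is a generalized Cayley graph of a left-quasigroup with a left identity; (c) $G$ is simple, deterministic and source-complete. Likewise, the following are equivalent: (a') $G$ is a generalized Cayley graph of a left-cancellative magma with a right identity; (b') $G$ is a generalized Cayley graph of a left-quasigroup with an identity; (c') $G$ is simple, deterministic, source-complete and loop-complete.
   Context: A graph is a non-empty set $G\subseteq V\times A\times V$ of labeled edges $s\xrightarrow{a}_G t$; $V_G$ is the set of vertices occurring in edges, $A_G$ the set of labels; $G$ is finitely labeled if $A_G$ is finite. A graph is a generalized Cayley graph of a magma $(M,\cdot)$ if it equals $\mathcal{C}\langle M,Q\rangle=\{(p,\langle q\rangle,p\cdot q): p\in M,\ q\in Q\}$ for some $Q\subseteq M$ and injective $\langle\,\rangle:Q\to A$. A magma is left-cancellative if $r\cdot p=r\cdot q\Rightarrow p=q$; a left-quasigroup if for all $p,q$ there is a unique $r$ with $p\cdot r=q$. Left identity: $e\cdot p=p$ for all $p$; right identity: $p\cdot e=p$ for all $p$; identity: both. $G$ is simple if no two edges share source and target; deterministic if $r\xrightarrow{a}s$, $r\xrightarrow{a}t$ imply $s=t$; source-complete if for every $s\in V_G$, $a\in A_G$ there is $t$ with $s\xrightarrow{a}_G t$; loop-complete if whenever some vertex has an $a$-labeled loop, every vertex has an $a$-labeled loop. *)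

(* Defs.v *)
From mathcomp Require Import all_boot all_classical.

Set Implicit Arguments.
Unset Strict Implicit.
Unset Printing Implicit Defensive.

Local Open Scope classical_set_scope.

(* A labeled graph is a non-empty edge set G : set (V * A * V), the triple
   (s, a, t) being the edge from s to t labeled by a.  Non-emptiness is kept
   as a separate hypothesis G !=set0. *)
Section LabeledGraphs.
Variables (V A : Type).
Implicit Type G : set (V * A * V).

Definition vertices G : set V :=
  [set s | exists a t, G (s, a, t) \/ G (t, a, s)].

Definition labels G : set A := [set a | exists s t, G (s, a, t)].

Definition simple G : Prop :=
  forall s a b t, G (s, a, t) -> G (s, b, t) -> a = b.

Definition deterministic G : Prop :=
  forall r a s t, G (r, a, s) -> G (r, a, t) -> s = t.

Definition source_complete G : Prop :=
  forall s a, vertices G s -> labels G a -> exists t, G (s, a, t).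

Definition loop_complete G : Prop :=
  forall a, (exists s, G (s, a, s)) -> forall t, vertices G t -> G (t, a, t).

End LabeledGraphs.

Section Magmas.
Variables (M : Type) (op : M -> M -> M).

Definition left_cancellative : Prop :=
  forall r p q, op r p = op r q -> p = q.

Definition left_quasigroup : Prop :=
  forall p q, exists! r, op p r = q.

Definition identity (e : M) : Prop := left_id e op /\ right_id e op.

End Magmas.

(* As a generalized Cayley graph has to be equal to G, not merely isomorphic
   to it, the underlying set of the magma is a subset M of V; the operation
   is defined on the corresponding subtype. *)
Section CayleyGraphs.
Variables (V A : Type) (M : set V) (op : M -> M -> M).

Definition Cayley_graph (Q : set M) (lab : Q -> A) : set (V * A * V) :=
  [set x | exists (p : M) (q : Q),
     x = (\val p, lab q, \val (op p (\val q)))].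

Definition generalized_Cayley_graph (G : set (V * A * V)) : Prop :=
  exists (Q : set M) (lab : Q -> A), injective lab /\ G = Cayley_graph lab.

End CayleyGraphs.

(* Main.v *)
Require Import Defs.
From mathcomp Require Import all_boot all_classical.

Set Implicit Arguments.
Unset Strict Implicit.
Unset Printing Implicit Defensive.

Local Open Scope classical_set_scope.

(** In a left-cancellative magma the translations [op p] are injective, which
    gives the axioms on [G]; a right identity makes [p] carry a loop labeled by
    [q] exactly when [q] is that identity. Conversely, fix a vertex [e] and
    identify each label [a] with the target of the [a]-edge leaving [e].
    The translation by a vertex [p] must send the [a]-target of [e] to the
    [a]-target of [p] for each label [a]; by simplicity this is a finite partial
    injection of the vertex set, hence extends to a permutation of it. If [G] is
    loop-complete, the further prescription [e |-> p] keeps the partial map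
    injective, and makes [e] a right identity. *)

(** By induction on [s], the permutation [h] found for the tail is followed by the transposition
    [sw] of [h (f i)] and [g i]. For [j] in the tail, [sw] fixes [h (f j) = g j] unless [f j = f i],
    in which case [g j = g i] as well. *)
Lemma finite_partial_injection_bij (I M : eqType) (s : seq I) (f g : I -> M) :
    {in s &, forall i j, f i = f j <-> g i = g j} ->
  exists2 h : M -> M, bijective h & {in s, forall i, h (f i) = g i}.
Proof.
elim: s => [_|i s IHs fg]; first by exists id => //; exists id.
have [|h bij_h hfg] := IHs.
  by move=> j k js ks; apply: fg; rewrite inE ?js ?ks orbT.
pose sw z := if z == h (f i) then g i else if z == g i then h (f i) else z.
have swK : involutive sw.
  move=> z; rewrite /sw.
  have [->|] := eqVneq z (h (f i)).
    by rewrite eqxx; case: eqVneq => [->|].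
  have [->|] := eqVneq z (g i); first by rewrite eqxx.
  by move=> /negPf zg /negPf zhf; rewrite zhf zg.
exists (sw \o h); first exact: bij_comp (inv_bij swK) bij_h.
move=> j; rewrite inE /sw /= => /predU1P[->|js]; first by rewrite eqxx.
have [/(bij_inj bij_h)|hfij] := eqVneq (h (f j)) (h (f i)).
  by rewrite fg ?inE ?eqxx ?js ?orbT.
rewrite hfg //; case: eqVneq => // /esym/esym.
by rewrite -fg ?inE ?eqxx ?js ?orbT // => fji; rewrite fji eqxx in hfij.
Qed.

Lemma finite_partial_injection_extension (I M : Type) (D : set I)
    (f g : I -> M) (finD : finite_set D) :
    (forall i j, D i -> D j -> f i = f j <-> g i = g j) ->
  exists2 h : M -> M, bijective h & forall i, D i -> h (f i) = g i.
Proof.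
have [s ->] := (@finite_seqP {classic I} D).1 finD.
exact: (@finite_partial_injection_bij {classic I} {classic M}).
Qed.

Lemma left_quasigroup_bij (M : Type) (op : M -> M -> M) :
  (forall p, bijective (op p)) -> left_quasigroup op.
Proof.
move=> bij_op p q; have [k opK kK] := bij_op p.
by exists (k q); split=> [|r <-]; rewrite ?kK ?opK.
Qed.

Lemma left_quasigroup_cancellative (M : Type) (op : M -> M -> M) :
  left_quasigroup op -> left_cancellative op.
Proof.
move=> qop r p q eqpq; have [t [_ tU]] := qop r (op r q).
by rewrite -(tU p eqpq) (tU q erefl).
Qed.

Lemma source_vertex (V A : Type) (G : set (V * A * V)) s a t :
  G (s, a, t) -> vertices G s.
Proof. by exists a, t; left. Qed.

Lemma target_vertex (V A : Type) (G : set (V * A * V)) s a t :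
  G (s, a, t) -> vertices G t.
Proof. by exists a, s; right. Qed.

Lemma generalized_Cayley_graph_vertex (V A : Type) (M : set V)
    (op : M -> M -> M) (G : set (V * A * V)) s :
  generalized_Cayley_graph op G -> vertices G s -> exists p : M, s = val p.
Proof.
move=> [Q [lab [_ ->]]] [a [t [] [p [q [sE _ tE]]]]]; first by exists p.
by exists (op p (val q)).
Qed.

(** Simplicity comes from cancellation, determinism from the injectivity of [lab], and
    source-completeness from the totality of [op]. *)
Lemma generalized_Cayley_graph_axioms (V A : Type) (M : set V)
    (op : M -> M -> M) (G : set (V * A * V)) :
    left_cancellative op -> generalized_Cayley_graph op G ->
  [/\ simple G, deterministic G & source_complete G].
Proof.
move=> cop genG; have vertG s := @generalized_Cayley_graph_vertex _ _ _ _ _ s genG.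
have [Q [lab [lab_inj GE]]] := genG.
split.
- rewrite GE => _ _ b _ [p [q [-> -> ->]]] [p' [q' [/val_inj <- -> /val_inj/cop]]].
  by move=> /val_inj ->.
- rewrite GE => _ _ _ t [p [q [-> -> ->]]] [p' [q' [/val_inj <- /lab_inj <- ->]]] //.
- move=> s a /vertG[p ->]; rewrite GE => -[_ [_ [_ [q [_ -> _]]]]].
  by exists (val (op p (val q))), p, q.
Qed.

Lemma generalized_Cayley_graph_loop_complete (V A : Type) (M : set V)
    (op : M -> M -> M) (e : M) (G : set (V * A * V)) :
    left_cancellative op -> right_id e op -> generalized_Cayley_graph op G ->
  loop_complete G.
Proof.
move=> cop ope genG a [s Gsas] t /(generalized_Cayley_graph_vertex genG)[p ->].
have [Q [lab [_ GE]]] := genG; move: Gsas; rewrite GE => -[r [q [-> ->]]].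
(* The loop at [r] reads [op r e = op r (val q)], so [q] is [e]. *)
move=> /val_inj; rewrite -[in LHS](ope r) => /cop eq_e.
by exists p, q; rewrite -[\val q]eq_e ope.
Qed.

Lemma source_complete_target (V A : Type) (G : set (V * A * V)) :
    source_complete G ->
  exists tgt : vertices G -> A -> vertices G,
    forall p a, labels G a -> G (val p, a, val (tgt p a)).
Proof.
move=> scG.
suff /choice[tgt tgtP] : forall x : vertices G * A, exists t : vertices G,
    labels G x.2 -> G (val x.1, x.2, val t).
  by exists (fun p a => tgt (p, a)) => p a; apply: (tgtP (p, a)).
(* When [a] labels no edge, [p] is a dummy value. *)
move=> [p a]; have [La|nLa] := pselect (labels G a); last by exists p.
have [t Gpt] := scG _ _ (set_valP p) La.
by exists (SigSub (mem_set (target_vertex Gpt))).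
Qed.

(** The generators are the targets of the edges leaving [e], each named by the label of its edge.
    Determinism gives [q = tgt e (lab q)], hence the injectivity of [lab]. Simplicity gives
    [lab (tgt e a) = a], so every label is reached. *)
Lemma generalized_Cayley_graph_translations (V A : Type)
    (G : set (V * A * V)) (e : vertices G)
    (tgt : vertices G -> A -> vertices G)
    (op : vertices G -> vertices G -> vertices G) :
    simple G -> deterministic G ->
    (forall p a, labels G a -> G (val p, a, val (tgt p a))) ->
    (forall p a, labels G a -> op p (tgt e a) = tgt p a) ->
  generalized_Cayley_graph op G.
Proof.
move=> simG detG tgtP opP.
pose Q : set (vertices G) := [set q | exists a, G (val e, a, val q)].
have /choice[lab labP] : forall q : Q, exists a, G (val e, a, val (val q)).
  by move=> q; apply: set_valP q.
have labL q : labels G (lab q) by exists (val e), (val (val q)).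
have tgt_lab q : tgt e (lab q) = val q.
  exact/val_inj/(detG _ _ _ _ (tgtP _ _ (labL q)) (labP q)).
exists Q, lab; split.
  by move=> q q' eq_lab; apply: val_inj; rewrite -!tgt_lab eq_lab.
apply/seteqP; split=> [[[s a] t] Gsat|_ [p [q ->]]]; last first.
  by rewrite -tgt_lab opP //; apply: tgtP.
have La : labels G a by exists s, t.
have Qa : Q (tgt e a) by exists a; apply: tgtP.
pose p : vertices G := SigSub (mem_set (source_vertex Gsat)).
pose q : Q := SigSub (mem_set Qa).
exists p, q; rewrite /= opP // (simG _ _ _ _ (labP q) (tgtP _ _ La)).
by rewrite (detG _ _ _ _ Gsat (tgtP p a La)).
Qed.

(* The index [None] stands for an extra loop at every vertex. *)
Lemma translations_exist (V A : Type) (G : set (V * A * V)) (e : vertices G)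
    (D : set (option A)) (tgt : vertices G -> A -> vertices G)
    (tgt' := fun p i => oapp (tgt p) p i) :
    finite_set D ->
    (forall p q i j, D i -> D j -> tgt' p i = tgt' p j -> tgt' q i = tgt' q j) ->
  exists op : vertices G -> vertices G -> vertices G,
    [/\ left_quasigroup op, left_id e op
      & forall p i, D i -> op p (tgt' e i) = tgt' p i].
Proof.
move=> finD tgtD.
have /choice[op opP] : forall p, exists h : vertices G -> vertices G,
    [/\ bijective h, p = e -> h =1 id
      & forall i, D i -> h (tgt' e i) = tgt' p i].
  (* At [p = e] the prescription is trivial; choosing [id] there makes [e] a left identity. *)
  move=> p; have [->|pe] := pselect (p = e).
    by exists id; split=> //; exists id.
  have [|h bij_h hP] := @finite_partial_injection_extension _ _ D
      (tgt' e) (tgt' p) finD.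
    (* Both directions follow from [tgtD], as it quantifies over all pairs of vertices. *)
    by move=> i j Di Dj; split; apply: tgtD.
  by exists h; split.
exists op; split; last by move=> p; have [] := opP p.
  by apply: left_quasigroup_bij => p; have [] := opP p.
by have [_ + _] := opP e; apply.
Qed.

(** The flag [L] treats both equivalences at once: when it is true, the index [None] joins the
    labels and prescribes [op p e = p]. *)
Lemma graph_left_quasigroup (V A : Type) (G : set (V * A * V))
    (e : vertices G) (L : bool) :
    finite_set (labels G) ->
    simple G -> deterministic G -> source_complete G ->
    (L -> loop_complete G) ->
  exists op : vertices G -> vertices G -> vertices G,
    [/\ left_quasigroup op, left_id e op, L -> right_id e op
      & generalized_Cayley_graph op G].
Proof.
move=> finG simG detG scG lcG.
have [tgt tgtP] := source_complete_target scG.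
pose D i := if i is Some a then labels G a else is_true L.
have finD : finite_set D.
  apply: (@sub_finite_set _ _ ((Some @` labels G) `|` [set None])).
    by case=> [a La|_]; [left; exists a|right].
  by rewrite finite_setU; split; [exact: finite_image|exact: finite_set1].
have [|op [qop op_e opP]] := @translations_exist _ _ G e D tgt finD.
  (* This handles a coincidence between a label and [None]: an [a]-loop at [p] forces one at [q],
     which by determinism is the [a]-edge to [tgt q a]. *)
  have loopL p q a : L -> labels G a -> tgt p a = p -> tgt q a = q.
    move=> /lcG lcGL La tgt_p; apply/val_inj/(detG _ _ _ _ (tgtP q a La)).
    by apply: lcGL (set_valP q); exists (val p); rewrite -{2}tgt_p; apply: tgtP.
  move=> p q [a|] [b|] //= La Lb.
  - move=> eq_tgt; have := tgtP p b Lb; rewrite -eq_tgt => /simG.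
    by move=> /(_ _ (tgtP p a La)) ->.
  - exact: loopL.
  - by move=> /esym/(loopL p q b La Lb)/esym.
exists op; split=> // [LT p|]; first exact: (opP p None).
apply: (@generalized_Cayley_graph_translations _ _ _ e) tgtP _ => // p a.
exact: (opP p (Some a)).
Qed.

Theorem theorem6p6 (V A : Type) (G : set (V * A * V))
    (G_neq0 : G !=set0) (finA : finite_set (labels G)) :
  [<-> exists (M : set V) (op : M -> M -> M),
         left_cancellative op /\ generalized_Cayley_graph op G;
       exists (M : set V) (op : M -> M -> M),
         [/\ left_quasigroup op, exists e : M, left_id e op
           & generalized_Cayley_graph op G];
       [/\ simple G, deterministic G & source_complete G]]
  /\
  [<-> exists (M : set V) (op : M -> M -> M),
         [/\ left_cancellative op, exists e : M, right_id e op
           & generalized_Cayley_graph op G];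
       exists (M : set V) (op : M -> M -> M),
         [/\ left_quasigroup op, exists e : M, identity op e
           & generalized_Cayley_graph op G];
       [/\ simple G, deterministic G, source_complete G & loop_complete G]].
Proof.
have [[[s a] t] Gsat] := G_neq0.
pose e : vertices G := SigSub (mem_set (source_vertex Gsat)).
split; tfae.
(* The given magma serves only to obtain the axioms on [G]; the quasigroup is built afresh on
   [vertices G]. *)
- move=> [M [op [cop genG]]].
  have [simG detG scG] := generalized_Cayley_graph_axioms cop genG.
  have [op' [qop' op'e _ genG']] :=
    @graph_left_quasigroup _ _ G e false finA simG detG scG ltac:(by []).
  by exists (vertices G), op'; split=> //; exists e.
- move=> [M [op [/left_quasigroup_cancellative cop _ genG]]].
  exact: generalized_Cayley_graph_axioms cop genG.
- move=> [simG detG scG].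
  have [op' [/left_quasigroup_cancellative cop' _ _ genG']] :=
    @graph_left_quasigroup _ _ G e false finA simG detG scG ltac:(by []).
  by exists (vertices G), op'.
- move=> [M [op [cop [e' ope'] genG]]].
  have [simG detG scG] := generalized_Cayley_graph_axioms cop genG.
  have lcG := generalized_Cayley_graph_loop_complete cop ope' genG.
  have [op' [qop' op'e ope genG']] :=
    @graph_left_quasigroup _ _ G e true finA simG detG scG (fun=> lcG).
  by exists (vertices G), op'; split=> //; exists e; split=> //; apply: ope.
- move=> [M [op [/left_quasigroup_cancellative cop [e' [_ ope']] genG]]].
  have [simG detG scG] := generalized_Cayley_graph_axioms cop genG.
  by split=> //; apply: generalized_Cayley_graph_loop_complete cop ope' genG.
- move=> [simG detG scG lcG].
  have [op' [/left_quasigroup_cancellative cop' _ ope genG']] :=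
    @graph_left_quasigroup _ _ G e true finA simG detG scG (fun=> lcG).
  by exists (vertices G), op'; split=> //; exists e; apply: ope.
Qed.
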